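(* Let $G$ be a connected Lie group and let $\Sigma_G$ be a linear control system on $G$ satisfying the Lie algebra rank condition (LARC). Then $$\mathcal{O}^+(e)\ \text{is bounded}\iff \overline{\mathcal{O}^+(e)}\ \text{is a compact control set of }\Sigma_G.$$ In particular, if $\mathcal{O}^+(e)$ is bounded and $\Sigma_G$ is controllable, then $G$ is a compact group.
   Context: Let $G$ be a connected Lie group with identity $e$ and Lie algebra $\mathfrak{g}$ (identified with the right-invariant vector fields). A subset of $G$ is bounded if its closure is compact. A vector field $\mathcal{X}$ on $G$ is linear if its flow $\{\varphi_t\}_{t\in\mathbb{R}}$ is a one-parameter group of automorphisms of $G$. Associated with it is a derivation $\mathcal{D}$ of $\mathfrak{g}$ with $(d\varphi_t)_e=\mathrm{e}^{t\mathcal{D}}$ for all $t\in\mathbb{R}$. A linear control system $\Sigma_G$ on $G$ is the family of ODEs $\dot g(t)=\mathcal{X}(g(t))+\sum_{i=1}^m u_i(t)Y^i(g(t))$, where $\mathcal{X}$ (the drift) is a linear vector field, $Y^1,\dots,Y^m$ are right-invariant vector fields, and $u=(u_1,\dots,u_m)\in\mathcal{U}$, the set of piecewise constant functions $u:\mathbb{R}\to\mathbb{R}^m$ with values in a fixed compact convex set $\Omega\subset\mathbb{R}^m$ with $0\in\operatorname{int}\Omega$. The solution with initial value $x$ and control $u$ is $t\mapsto\phi(t,x,u)$, defined for all $t\in\mathbb{R}$. The positive orbit of $x$ is $\mathcal{O}^+(x)=\{\phi(t,x,u): t>0,\ u\in\mathcal{U}\}$. LARC: $\mathfrak{g}$ is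 the smallest $\mathcal{D}$-invariant Lie subalgebra containing $Y^1,\dots,Y^m$. Control set: a subset $D\subset G$ is a control set of $\Sigma_G$ if (i) for every $x\in D$ there exists $u\in\mathcal{U}$ with $\phi(t,x,u)\in D$ for all $t\ge 0$; (ii) $D\subset\overline{\mathcal{O}^+(x)}$ for every $x\in D$; (iii) $D$ is maximal (with respect to inclusion) among subsets with properties (i) and (ii). The system $\Sigma_G$ is controllable if the whole group $G$ is a control set. *)

(* Defs.v *)
From HB Require Import structures.
From mathcomp Require Import all_boot all_order all_algebra.
From mathcomp Require Import all_classical all_reals all_analysis.

Set Implicit Arguments.
Unset Strict Implicit.
Unset Printing Implicit Defensive.

Import Order.TTheory GRing.Theory Num.Theory.
Import numFieldNormedType.Exports.

Local Open Scope classical_set_scope.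
Local Open Scope ring_scope.

(* [Ck_on k U f] is meant for open [U]; the values of [f] outside [U] are
   irrelevant. *)
Fixpoint Ck_on (R : realType) (V W : normedModType R) (k : nat) (U : set V)
    (f : V -> W) : Prop :=
  match k with
  | 0%N => forall x, U x -> {for x, continuous f}
  | k'.+1 => (forall x, U x -> differentiable f x) /\
             (forall v : V, Ck_on k' U (fun x => 'D_v f x))
  end.

Definition smooth_on (R : realType) (V W : normedModType R) (U : set V)
    (f : V -> W) : Prop :=
  forall k, Ck_on k U f.

(* [coord] is a homeomorphism from the open set [dom] onto the open set
   [coord @` dom], with inverse [param]; both functions are arbitrary
   elsewhere. *)
Record chart (R : realType) (n : nat) (M : topologicalType) := Chart {
  dom : set M;
  coord : M -> 'rV[R]_n;
  param : 'rV[R]_n -> M;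
  dom_open : open dom;
  cod_open : open (coord @` dom);
  coordK : forall x, dom x -> param (coord x) = x;
  coord_continuous : forall x, dom x -> {for x, continuous coord};
  param_continuous : forall y, (coord @` dom) y -> {for y, continuous param}
}.

Definition cod (R : realType) (n : nat) (M : topologicalType)
  (c : chart R n M) : set 'rV[R]_n := coord c @` dom c.

Definition smoothly_compatible (R : realType) (n : nat) (M : topologicalType)
    (c d : chart R n M) : Prop :=
  smooth_on (cod c `&` param c @^-1` dom d) (coord d \o param c).

HB.mixin Record isSmoothManifold (R : realType) (n : nat) M
    of Topological M := {
  manifold_hausdorff : hausdorff_space M;
  manifold_second_countable : @second_countable M;
  atlas : set (chart R n M);
  atlas_cover : forall x : M, exists2 c, atlas c & dom c x;
  atlas_compatible : forall c d, atlas c -> atlas d -> smoothly_compatible c d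
}.

#[short(type="smoothManifoldType")]
HB.structure Definition SmoothManifold (R : realType) (n : nat) :=
  {M of Topological M & isSmoothManifold R n M}.

Arguments atlas {R n} s.

Definition smooth_fun (R : realType) (n : nat) (M : smoothManifoldType R n)
    (f : M -> R) : Prop :=
  forall c, atlas M c -> smooth_on (cod c) (f \o param c).

Definition smooth_map (R : realType) (n k : nat) (M : smoothManifoldType R n)
    (N : smoothManifoldType R k) (F : M -> N) : Prop :=
  continuous F /\
  forall c d, atlas M c -> atlas N d ->
    smooth_on (cod c `&` param c @^-1` (F @^-1` dom d))
              (coord d \o F \o param c).

(* Smoothness of a map on the product manifold [M1 * M2], read in product
   charts. *)
Definition smooth_map2 (R : realType) (n1 n2 k : nat)
    (M1 : smoothManifoldType R n1) (M2 : smoothManifoldType R n2)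
    (N : smoothManifoldType R k) (F : M1 -> M2 -> N) : Prop :=
  continuous (fun p : M1 * M2 => F p.1 p.2) /\
  forall c1 c2 d, atlas M1 c1 -> atlas M2 c2 -> atlas N d ->
    smooth_on
      [set p : 'rV[R]_n1 * 'rV[R]_n2 |
        [/\ cod c1 p.1, cod c2 p.2 & dom d (F (param c1 p.1) (param c2 p.2))]]
      (fun p => coord d (F (param c1 p.1) (param c2 p.2))).

Definition operator (R : realType) (M : Type) := (M -> R) -> (M -> R).

(* Vector fields are the derivations of the algebra of smooth functions.  An
   operator takes all functions as arguments; the convention that it vanishes
   on those that are not smooth makes equality of operators coincide with
   equality of vector fields, and is preserved by linear combinations and
   commutators. *)
Definition vector_field (R : realType) (n : nat) (M : smoothManifoldType R n)
    (X : operator R M) : Prop :=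
  [/\ (forall f, smooth_fun f -> smooth_fun (X f)),
      (forall f, ~ smooth_fun f -> X f = 0),
      (forall (a : R) f g, smooth_fun f -> smooth_fun g ->
         X (fun x => a * f x + g x) = fun x => a * X f x + X g x) &
      (forall f g, smooth_fun f -> smooth_fun g ->
         X (fun x => f x * g x) = fun x => X f x * g x + f x * X g x)].

Definition bracket (R : realType) (M : Type) (X Y : operator R M) :
    operator R M :=
  fun f => X (Y f) - Y (X f).

(* The velocity of the curve [c] at time [t] is the value of [X] at [c t]. *)
Definition velocity_at (R : realType) (n : nat) (M : smoothManifoldType R n)
    (c : R -> M) (t : R) (X : operator R M) : Prop :=
  forall f, smooth_fun f -> is_derive t 1 (f \o c) (X f (c t)).

Definition is_flow (R : realType) (n : nat) (M : smoothManifoldType R n)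
    (X : operator R M) (phi : R -> M -> M) : Prop :=
  forall x : M,
    [/\ phi 0 x = x, continuous (phi ^~ x) &
        forall t, velocity_at (phi ^~ x) t X].

HB.mixin Record isLieGroup (R : realType) (n : nat) G
    of SmoothManifold R n G & Group G := {
  mul_smooth : smooth_map2 (fun x y : G => (x * y)%g);
  inv_smooth : smooth_map (fun x : G => x^-1%g)
}.

#[short(type="lieGroupType")]
HB.structure Definition LieGroup (R : realType) (n : nat) :=
  {G of SmoothManifold R n G & Group G & isLieGroup R n G}.

Definition lie_automorphism (R : realType) (n : nat) (G : lieGroupType R n)
    (psi : G -> G) : Prop :=
  [/\ {morph psi : x y / (x * y)%g}, smooth_map psi &
      exists2 psi', smooth_map psi' & cancel psi psi' /\ cancel psi' psi].

Definition one_parameter_automorphisms (R : realType) (n : nat)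
    (G : lieGroupType R n) (phi : R -> G -> G) : Prop :=
  [/\ forall t, lie_automorphism (phi t), phi 0 = id &
      forall s t, phi (s + t) = phi s \o phi t].

(* The Lie algebra, as right-invariant vector fields: the pushforward of [Y]
   under the translation [x |-> x * g] is [Y]. *)
Definition lie_algebra (R : realType) (n : nat) (G : lieGroupType R n) :
    set (operator R G) :=
  [set Y | vector_field Y /\
    forall (g : G) f, smooth_fun f ->
      Y (fun x => f (x * g)%g) = fun x => Y f (x * g)%g].

Arguments lie_algebra {R n} G _.

Definition lie_subalgebra (R : realType) (n : nat) (G : lieGroupType R n)
    (h : set (operator R G)) : Prop :=
  [/\ h `<=` lie_algebra G, h 0,
      forall (a : R) X Y, h X -> h Y -> h (a *: X + Y) &
      forall X Y, h X -> h Y -> h (bracket X Y)].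

Definition lie_derivation (R : realType) (n : nat) (G : lieGroupType R n)
    (D : operator R G -> operator R G) : Prop :=
  [/\ forall X, lie_algebra G X -> lie_algebra G (D X),
      forall (a : R) X Y, lie_algebra G X -> lie_algebra G Y ->
        D (a *: X + Y) = a *: D X + D Y &
      forall X Y, lie_algebra G X -> lie_algebra G Y ->
        D (bracket X Y) = bracket (D X) Y + bracket X (D Y)].

(* Differential at [x] of [psi], applied to the value at [x] of [Y]: a tangent
   vector at [psi x], as a point derivation. *)
Definition differential_at (R : realType) (M : Type) (psi : M -> M) (x : M)
    (Y : operator R M) : (M -> R) -> R :=
  fun f => Y (f \o psi) x.

(* (d phi_t)_e = exp (t D), where a right-invariant vector field is identified
   with its value at e.  As the Lie algebra is finite-dimensional, convergence
   of the exponential series amounts to convergence when evaluated at each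
   smooth function. *)
Definition differential_is_exp (R : realType) (n : nat) (G : lieGroupType R n)
    (phi : R -> G -> G) (D : operator R G -> operator R G) : Prop :=
  forall (t : R) Y f, lie_algebra G Y -> smooth_fun f ->
    series (fun k => t ^+ k / k`!%:R * iter k D Y f 1%g) @ \oo
      --> differential_at (phi t) 1%g Y f.

(* The flow and, on the Lie algebra, the derivation are determined by the
   drift. *)
Record linear_control_system (R : realType) (n : nat) (G : lieGroupType R n)
    (m : nat) := LinearControlSystem {
  drift : operator R G;
  flow : R -> G -> G;
  deriv : operator R G -> operator R G;
  input : 'I_m -> operator R G;
  control_range : set 'rV[R]_m;
  drift_vector_field : vector_field drift;
  drift_flow : is_flow drift flow;
  flow_automorphisms : one_parameter_automorphisms flow;
  deriv_derivation : lie_derivation deriv;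
  flow_deriv : differential_is_exp flow deriv;
  input_right_invariant : forall i, lie_algebra G (input i);
  range_compact : compact control_range;
  range_convex :
    convex_set (control_range : set (convex_lmodType 'rV[R]_m));
  range_interior : interior control_range 0
}.

(* Finitely many switching times on every bounded interval; the values at the
   switching times themselves are unconstrained. *)
Definition piecewise_constant (R : realType) (T : Type) (u : R -> T) : Prop :=
  forall a b : R, exists s : seq R, forall x y,
    a < x -> x <= y -> y < b ->
    (forall z, z \in s -> ~~ (x <= z <= y)) -> u x = u y.

Section LinearControlSystem.
Context {R : realType} {n : nat} {G : lieGroupType R n} {m : nat}.
Variable Sigma : linear_control_system G m.
Implicit Types (u : R -> 'rV[R]_m) (x : G) (D : set G).

Definition LARC : Prop :=
  forall h, lie_subalgebra h -> (forall i, h (input Sigma i)) ->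
    (forall X, h X -> h (deriv Sigma X)) -> h = lie_algebra G.

Definition admissible u : Prop :=
  piecewise_constant u /\ forall t, control_range Sigma (u t).

Definition system_field (w : 'rV[R]_m) : operator R G :=
  drift Sigma + \sum_(i < m) w 0 i *: input Sigma i.

(* [c] is the solution t |-> phi(t, x, u): a continuous curve that satisfies
   the differential equation away from the switching times of [u]. *)
Definition solution x u (c : R -> G) : Prop :=
  [/\ continuous c, c 0 = x &
      forall t, (\forall s \near t, u s = u t) ->
        velocity_at c t (system_field (u t))].

Definition positive_orbit x : set G :=
  [set y | exists u c (t : R),
    [/\ admissible u, solution x u c, 0 < t & c t = y]].

Definition controlled_invariant D : Prop :=
  forall x, D x -> exists u c,
    [/\ admissible u, solution x u c & forall t : R, 0 <= t -> D (c t)].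

Definition approximately_reachable D : Prop :=
  forall x, D x -> D `<=` closure (positive_orbit x).

Definition control_set D : Prop :=
  [/\ controlled_invariant D, approximately_reachable D &
      forall D', controlled_invariant D' -> approximately_reachable D' ->
        D `<=` D' -> D' = D].

Definition controllable : Prop := control_set [set: G].

End LinearControlSystem.

(* Not [bounded_set], which is metric boundedness in a normed module. *)
Definition bounded_subset (T : topologicalType) (A : set T) : Prop :=
  compact (closure A).

(* Main.v *)
Require Import Defs.
From HB Require Import structures.
From mathcomp Require Import all_boot all_order all_algebra.
From mathcomp Require Import all_classical all_reals all_analysis.
From mathcomp Require Import lra.

(* Let C be the closure of the positive orbit of e, assumed compact, let x be
   in C, and let r be an accumulation point of phi_t(x) as t tends to infinity,
   phi being the flow of the drift.  The solution from x is the solution k from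
   e times the orbit of x under the drift, and k can be delayed by staying at
   e, so h phi_t(x) is in the positive orbit of x for every h in that of e and
   every large t.  In the limit C r lies both in C and in the closure of the
   positive orbit of x.  The powers of r then stay in C and, by compactness,
   accumulate at r^-1, so that C r^-1 is in C too, and C = (C r^-1) r lies in
   the closure of the positive orbit of x. *)

Set Implicit Arguments.
Unset Strict Implicit.
Unset Printing Implicit Defensive.

Import Order.TTheory GRing.Theory Num.Theory.
Import numFieldNormedType.Exports.

Local Open Scope classical_set_scope.
Local Open Scope ring_scope.

(** * Calculus of C^k maps *)

Section Ck_calculus.
Context {R : realType}.
Implicit Types V W : normedModType R.

(** The first-order expansion at [x] only involves points near [x], so [g] inherits that of [f];
    uniqueness of the differential does the rest. *)
Lemma near_eq_differentiable V W (f g : V -> W) x :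
  (\near x, f x = g x) -> differentiable f x -> differentiable g x.
Proof.
move=> fg df; have fgx : f x = g x := nbhs_singleton fg.
have [cdf /eqaddoP eqf] := (diff_locallyP x f).1 df.
have eqg : g \o shift x = cst (g x) + 'd f x +o_ 0 id.
  apply/eqaddoP => e e0; have fg0 : \forall y \near 0, f (y + x) = g (y + x).
    by move: fg; rewrite (near_shift 0) subr0.
  apply: filterS2 fg0 (eqf e e0) => y fgy.
  by rewrite !fctE /= fgy fgx.
have dgf : 'd g x = 'd f x :> (V -> W) by apply: diff_unique.
by apply/diff_locallyP; rewrite dgf.
Qed.

(** As [U] is open, equality on [U] holds near each of its points and so passes to directional
    derivatives. This allows derivative formulas valid only on [U]. *)
Lemma eq_Ck_on V W k (U : set V) (f g : V -> W) : open U ->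
  (forall x, U x -> f x = g x) -> Ck_on k U f -> Ck_on k U g.
Proof.
move=> oU; have nearU x : U x -> \forall y \near x, U y
  by move=> Ux; apply: open_nbhs_nbhs; split.
elim: k f g => [|k IH] f g fg /=.
  move=> cf x Ux; rewrite /prop_for /continuous_at -(fg x Ux).
  apply: cvg_trans (cf x Ux); apply: near_eq_cvg.
  by apply: filterS (nearU x Ux) => y Uy; rewrite fg.
move=> [df Ddf]; split=> [x Ux|v].
  apply: near_eq_differentiable (df x Ux).
  by apply: filterS (nearU x Ux) => y; exact: fg.
apply: IH (Ddf v) => x Ux; apply: near_eq_derive.
by apply: filterS (nearU x Ux) => y; exact: fg.
Qed.

(** Each clause of [Ck_on] is a condition at one point of the set, on derivatives taken in the whole
    space; hence any [O] containing [x] serves. *)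
Lemma Ck_on_local V W k (U : set V) (f : V -> W) :
  (forall x, U x -> exists2 O, O x & Ck_on k O f) -> Ck_on k U f.
Proof.
elim: k f => [|k IH] f H /=.
  by move=> x Ux; have [N xN cf] := H x Ux; exact: cf.
split=> [x Ux|v].
  by case: (H x Ux) => N xN [df _]; exact: df.
apply: IH => x Ux; case: (H x Ux) => N xN [_ Ddf].
by exists N => //; exact: Ddf.
Qed.

Lemma Ck_onW V W k (U : set V) (f : V -> W) : Ck_on k.+1 U f -> Ck_on k U f.
Proof.
elim: k f => [|k IH] f [df Ddf].
  by move=> x Ux; apply: differentiable_continuous; exact: df.
by split=> // v; exact: IH.
Qed.

Lemma Ck_on_cst V W k (U : set V) (a : W) : Ck_on k U (fun=> a).
Proof.
elim: k a => [|k IH] a /=; first by move=> x _; exact: cvg_cst.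
split=> [x _|v]; first exact: differentiable_cst.
have -> : (fun x : V => 'D_v (fun=> a) x) = fun=> 0 :> W.
  by apply/funext => x; rewrite derive_cst.
exact: IH.
Qed.

Lemma Ck_onD V W k (U : set V) (f g : V -> W) : open U ->
  Ck_on k U f -> Ck_on k U g -> Ck_on k U (fun x => f x + g x).
Proof.
move=> oU; elim: k f g => [|k IH] f g /=.
  by move=> cf cg x Ux; exact: cvgD (cf x Ux) (cg x Ux).
move=> [df Ddf] [dg Ddg]; split=> [x Ux|v].
  by apply: differentiableD; [exact: df|exact: dg].
apply: (eq_Ck_on oU) (IH _ _ (Ddf v) (Ddg v)) => x Ux.
by rewrite [RHS]deriveD//; apply: diff_derivable; [exact: df|exact: dg].
Qed.

Lemma Ck_onM V k (U : set V) (f g : V -> R) : open U ->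
  Ck_on k U f -> Ck_on k U g -> Ck_on k U (fun x => f x * g x).
Proof.
move=> oU; elim: k f g => [|k IH] f g.
  by move=> cf cg x Ux; exact: cvgM (cf x Ux) (cg x Ux).
move=> Cf Cg; have [[df Ddf] [dg Ddg]] := (Cf, Cg); split=> [x Ux|v].
  by apply: differentiableM; [exact: df|exact: dg].
apply: (eq_Ck_on oU) (Ck_onD oU (IH _ _ (Ck_onW Cf) (Ddg v))
  (IH _ _ (Ck_onW Cg) (Ddf v))) => x Ux.
by rewrite [RHS]deriveM//; apply: diff_derivable; [exact: df|exact: dg].
Qed.

Lemma Ck_on_sum V W k (I : Type) (s : seq I) (U : set V) (f : I -> V -> W) :
  open U -> (forall i, Ck_on k U (f i)) ->
  Ck_on k U (fun x => \sum_(i <- s) f i x).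
Proof.
move=> oU Cf; elim: s => [|i s IH].
  by under eq_fun do rewrite big_nil; exact: Ck_on_cst.
by under eq_fun do rewrite big_cons; exact: Ck_onD.
Qed.

Lemma Ck_on_coord V n k (U : set V) (g : V -> 'rV[R]_n) j : open U ->
  Ck_on k U g -> Ck_on k U (fun x => g x 0 j).
Proof.
move=> oU; elim: k g => [|k IH] g /=.
  move=> cg x Ux; apply: (@continuous_comp _ _ _ g (fun M : 'rV_n => M 0 j)).
    exact: cg.
  exact: coord_continuous.
move=> [dg Ddg]; split=> [x Ux|v].
  apply: (@differentiable_comp _ _ _ _ g (fun M : 'rV_n => M 0 j)).
    exact: dg.
  exact: differentiable_coord.
apply: (eq_Ck_on oU) (IH _ (Ddg v)) => x Ux.
by rewrite derive_mx ?mxE//; apply: diff_derivable; exact: dg.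
Qed.

(** [Ck_on] differentiates along fixed directions, whereas ['D_v g x] moves with [x]; expanding it
    in the standard basis leaves sums and products of maps in fixed directions. *)
Lemma derive_comp_rV V n (f : 'rV[R]_n -> R) (g : V -> 'rV[R]_n) x v :
  differentiable g x -> differentiable f (g x) ->
  'D_v (f \o g) x =
    \sum_(j < n) 'D_(delta_mx 0 j) f (g x) * ('D_v g x) 0 j.
Proof.
move=> dg df; rewrite deriveE; last exact: differentiable_comp.
rewrite diff_comp//= -(deriveE _ dg) [in LHS](row_sum_delta ('D_v g x)).
rewrite linear_sum; apply: eq_bigr => j _.
by rewrite linearZ /= -deriveE// mulrC.
Qed.

Lemma Ck_on_comp V n k (U : set V) (O : set 'rV[R]_n) (f : 'rV[R]_n -> R)
    (g : V -> 'rV[R]_n) : open U -> open O ->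
  (forall x, U x -> O (g x)) -> Ck_on k O f -> Ck_on k U g ->
  Ck_on k U (f \o g).
Proof.
move=> oU oO gUO; elim: k f g gUO => [|k IH] f g gUO.
  move=> cf cg x Ux; apply: continuous_comp; first exact: cg.
  by apply: cf; exact: gUO.
move=> [df Ddf] Cg; have [dg Ddg] := Cg; split=> [x Ux|v].
  by apply: differentiable_comp; [exact: dg|apply: df; exact: gUO].
have : Ck_on k U (fun x => \sum_(j < n)
    ((fun y => 'D_(delta_mx 0 j) f y) \o g) x * ('D_v g x) 0 j).
  apply: Ck_on_sum => // j; apply: Ck_onM => //.
    by apply: (IH _ _ gUO (Ddf _)); exact: Ck_onW.
  exact: Ck_on_coord (Ddg v).
apply: (eq_Ck_on oU) => x Ux; rewrite -derive_comp_rV//; first exact: dg.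
by apply: df; exact: gUO.
Qed.

(* The slice [p |-> F (p, q)] inherits regularity, since its derivative along
   [v] is the slice of the derivative of [F] along [(v, 0)]. *)
Lemma Ck_on_slice V1 V2 W k (U : set (V1 * V2)%type) (F : V1 * V2 -> W) q :
  Ck_on k U F -> Ck_on k [set p | U (p, q)] (fun p => F (p, q)).
Proof.
have dpair p : differentiable (fun p => (p, q)) p.
  exact: (differentiable_pair (f := id) (g := fun=> q)).
elim: k F => [|k IH] F /=.
  move=> cF p Up; apply: (@continuous_comp _ _ _ (fun p => (p, q)) F).
    exact: differentiable_continuous.
  exact: cF.
move=> [dF DdF]; split=> [p Up|v].
  by apply: (@differentiable_comp _ _ _ _ (fun p => (p, q)) F) => //; exact: dF.
have -> : (fun p => 'D_v (fun p => F (p, q)) p) =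
          (fun p => ('D_(v, 0) F) (p, q)).
  apply/funext => p; rewrite /derive.
  apply: (congr1 (fun g : R -> W => lim (g @ 0^'))).
  apply/funext => h /=.
  have -> : h *: (v, 0) + (p, q) = (h *: v + p, h *: (0 : V2) + q) by [].
  by rewrite scaler0 add0r.
exact: (IH _ (DdF (v, 0))).
Qed.

End Ck_calculus.

(** * Manifolds and the topology of Lie groups *)

(** Completeness of the model space is what [Baire] asks for below. *)
HB.instance Definition _ (R : realType) (n : nat) := Complete.on 'rV[R]_n.

Section Manifold.
Context {R : realType} {n : nat} {M : smoothManifoldType R n}.

Lemma smooth_fun_continuous (f : M -> R) : smooth_fun f -> continuous f.
Proof.
move=> sf x; have [c cA cx] := atlas_cover x.
have nearc : \forall y \near x, dom c y.
  by apply: open_nbhs_nbhs; split=> //; exact: dom_open.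
have cf : {for x, continuous ((f \o param c) \o Defs.coord c)}.
  apply: continuous_comp; first exact: Defs.coord_continuous.
  by apply: (sf c cA 0%N); exists x.
rewrite /continuous_at -[f x]/(f x) -{2}(coordK cx).
apply: cvg_trans cf; apply: near_eq_cvg.
by apply: filterS nearc => y cy /=; rewrite coordK.
Qed.

(** The closed sets are pulled back to a small closed ball in a chart, where the Baire theorem of
    the model space applies. *)
Lemma manifold_Baire (E : nat -> set M) (N : set M) : open N -> N !=set0 ->
  (forall i, closed (E i)) -> N `<=` \bigcup_i E i ->
  exists i x, N x /\ nbhs x (E i).
Proof.
move=> oN [x0 Nx0] cE NE; apply: contrapT => noint.
have [c _ cx0] := atlas_cover x0; set p0 := Defs.coord c x0.
have : nbhs p0 (cod c `&` param c @^-1` N).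
  apply: filterI.
    by apply: open_nbhs_nbhs; split; [exact: cod_open|exists x0].
  apply: param_continuous; first by exists x0.
  by rewrite coordK//; exact: open_nbhs_nbhs.
move=> /nbhs_closedballP[r rN]; set B := closed_ball p0 r%:num in rN.
(* [param c] is only known to be continuous on [cod c], which contains [B]; intersecting with [B]
   makes the pulled-back set closed in the whole space. *)
pose F i := ~` (B `&` param c @^-1` E i).
have oF i : open (F i).
  rewrite openE => p Fp; have [Bp|nBp] := pselect (B p); last first.
    have : nbhs p (~` B).
      apply: open_nbhs_nbhs; split=> //.
      exact/closed_openC/closed_ball_closed.
    by apply: filterS => q nBq [].
  have : nbhs p (param c @^-1` (~` E i)).
    apply: param_continuous; first by have [] := rN p Bp.
    apply: open_nbhs_nbhs; split; first exact/closed_openC/cE.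
    by move=> Ep; exact: Fp.
  by apply: filterS => q nEq [].
(* A nonempty open [O] missing [F i] lies in the ball, and its preimage under the chart is a
   neighborhood contained in [E i], against [noint]. *)
have dF i : dense (F i).
  move=> O [p Op] oO; apply: contrapT => OF0; apply: noint.
  have OB q : O q -> B q /\ E i (param c q).
    by move=> Oq; apply: contrapT => nq; apply: OF0; exists q; split.
  have [[[x cx cxp] Np] _] := (rN p (OB p Op).1, OB p Op).
  exists i, (param c p); split=> //.
  have px : param c p = x by rewrite -cxp coordK.
  have : nbhs (param c p) (dom c `&` Defs.coord c @^-1` O).
    rewrite px; apply: filterI.
      by apply: open_nbhs_nbhs; split=> //; exact: dom_open.
    by apply: Defs.coord_continuous => //; rewrite cxp; exact: open_nbhs_nbhs.
  by apply: filterS => y [cy /OB[_]]; rewrite coordK.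
have [||p [Bp Fp]] := Baire (fun i => conj (oF i) (dF i)) (O := ball p0 r%:num).
- by exists p0; exact: ballxx.
- exact: ball_open.
have {}Bp : B p by exact: subset_closed_ball.
have [_ /NE[i _ Ei]] := rN p Bp.
by apply: (Fp i).
Qed.

End Manifold.

Section LieGroupTopology.
Context {R : realType} {n : nat} {G : lieGroupType R n}.
Implicit Types (x y g : G).

Lemma cvg_mulg (T : Type) (F : set_system T) {FF : Filter F}
    (f g : T -> G) a b :
  f z @[z --> F] --> a -> g z @[z --> F] --> b ->
  (f z * g z)%g @[z --> F] --> (a * b)%g.
Proof.
by apply: continuous2_cvg; apply: (mul_smooth (s := G)).1 (a, b).
Qed.

Lemma cvg_invg (T : Type) (F : set_system T) {FF : Filter F} (f : T -> G) a :
  f z @[z --> F] --> a -> (f z)^-1%g @[z --> F] --> a^-1%g.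
Proof. by apply: continuous_cvg; apply: (inv_smooth (s := G)).1. Qed.

(** Translation by [g] is, in charts, a slice of the jointly smooth product; near each point, [f] is
    then read in a chart around the product. *)
Lemma smooth_fun_mulr (f : G -> R) g :
  smooth_fun f -> smooth_fun (fun x => f (x * g)%g).
Proof.
move=> sf c cA k; have [c2 c2A c2g] := atlas_cover g.
apply: Ck_on_local => p cp.
have [d dA dp] := atlas_cover (param c p * g)%g.
pose q := Defs.coord c2 g; have qg : param c2 q = g by exact: coordK.
(* The constant clause [cod c2 q] makes [U] literally the slice at [q] of the domain in
   [smooth_map2]. *)
pose U := [set p | [/\ cod c p, cod c2 q & dom d (param c p * param c2 q)%g]].
have c2q : cod c2 q by exists g.
exists U; first by split; rewrite // qg.
have oU : open U.
  rewrite openE => p' [cp' _ dp']; have : nbhs p' (cod c `&`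
      (fun p => param c p * param c2 q)%g @^-1` dom d).
    apply: filterI; first by apply: open_nbhs_nbhs; split=> //; exact: cod_open.
    have := cvg_mulg (param_continuous cp') (cvg_cst (param c2 q)).
    apply.
    by apply: open_nbhs_nbhs; split=> //; exact: dom_open.
  by apply: filterS => p'' [].
have Cd := Ck_on_slice q ((mul_smooth (s := G)).2 c c2 d cA c2A dA k).
have cdU p' : U p' -> cod d (Defs.coord d (param c p' * param c2 q)%g).
  by move=> [_ _ dp']; exists (param c p' * param c2 q)%g.
apply: (eq_Ck_on oU) (Ck_on_comp oU (@cod_open _ _ _ d) cdU (sf d dA k) Cd).
by move=> p' [_ _ dp'] /=; rewrite coordK// qg.
Qed.

Lemma nbhs1_mul (V : set G) : nbhs 1%g V ->
  exists2 W, nbhs 1%g W & forall x y, W x -> W y -> V (x * y)%g.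
Proof.
move=> nV; have := (mul_smooth (s := G)).1 (1%g, 1%g).
rewrite /continuous_at mulg1.
move=> /(_ V nV)[[A B] [/= nA nB] AB]; exists (A `&` B); first exact: filterI.
by move=> x y [Ax _] [_ By]; exact: (AB (x, y)).
Qed.

Lemma nbhs1_invmul (V : set G) : nbhs 1%g V ->
  exists2 W, nbhs 1%g W & forall x y, W x -> W y -> V (x^-1 * y)%g.
Proof.
move=> /nbhs1_mul[W nW WV].
have : (x : G)^-1%g @[x --> 1%g] --> 1%g.
  by rewrite -[in X in _ --> X]invg1; exact: cvg_invg.
move=> /(_ W nW) nW'; exists (W `&` (fun x => x^-1%g) @^-1` W).
  exact: filterI.
by move=> x y [_ Wx] [Wy _]; exact: WV.
Qed.

(** Regularity at the identity: a point [x] of [closure W] factors as [y * (y^-1 * x)] with both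
    factors in [W]. *)
Lemma nbhs1_closed (V : set G) : nbhs 1%g V ->
  exists2 W, nbhs 1%g W & closure W `<=` V.
Proof.
move=> /nbhs1_mul[W nW WV]; exists W => // x Wx.
have : (y^-1 * x)%g @[y --> x] --> (1 : G)%g.
  by rewrite -(mulVg x); apply: cvg_mulg (cvg_invg _) (cvg_cst _).
move=> /(_ W nW) /Wx[y [Wy Wyx]].
by rewrite -(mulVKg y x); exact: WV.
Qed.

End LieGroupTopology.

(** * The flow of the drift *)

Section RealDerivatives.
Context {R : realType}.
Implicit Types (f df : R -> R) (t h : R).

Lemma is_derive1P f t l : is_derive t 1 f l <->
  h^-1 * (f (h + t) - f t) @[h --> 0^'] --> l.
Proof.
have E : (fun h => h^-1 *: ((f \o shift t) (h *: 1) - f t)) =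
         (fun h => h^-1 * (f (h + t) - f t)).
  by apply/funext => h /=; rewrite [h%:A]mulr1.
split=> [[df <-]|cf]; first by rewrite -E; exact: df.
rewrite -E in cf; apply: DeriveDef; first exact: (cvgP l).
exact: cvg_lim cf.
Qed.

(** Covers increments of both signs. As [t] is an endpoint of the interval, the derivative is only
    asked for away from [t], as [is_derive_removable] requires. *)
Lemma MVT_signed f df t h :
  (forall x, `|x - t| <= `|h| -> x != t -> is_derive x 1 f (df x)) ->
  continuous f -> exists2 c, `|c - t| <= `|h| & f (h + t) - f t = df c * h.
Proof.
move=> fdf cf.
have [h0|h0] := leP 0 h.
- have [|x||c] := @MVT_segment R f df t (h + t).
  + by rewrite lerDr.
  + rewrite in_itv/= => /andP[tx xth]; apply: fdf; last by rewrite gt_eqF.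
    by rewrite !ger0_norm// ?subr_ge0 1?ltW// ltrBlDr.
  + exact: continuous_subspaceT.
  rewrite in_itv/= => /andP[tc cth] ->; exists c; last by rewrite addrK.
  by rewrite !ger0_norm// ?subr_ge0// lerBlDr.
- have [|x||c] := @MVT_segment R f df (h + t) t.
  + by rewrite gerDr ltW.
  + rewrite in_itv/= => /andP[tx xth]; apply: fdf; last by rewrite lt_eqF.
    rewrite !ler0_norm ?subr_le0 ?(ltW xth) ?(ltW h0)//; lra.
  + exact: continuous_subspaceT.
  rewrite in_itv/= => /andP[tc cth] E; exists c.
    rewrite !ler0_norm ?subr_le0 ?(ltW h0)//; lra.
  by rewrite -opprB E; lra.
Qed.

Lemma is_derive_removable f df t :
  (\forall s \near t^', is_derive (s : R) 1 f (df s)) -> continuous f ->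
  {for t, continuous df} -> is_derive t 1 f (df t).
Proof.
move=> fdf cf cdf; apply/is_derive1P.
move: fdf; rewrite /dnbhs /within /= => -[e /= e0 fdf].
(* The conditions on [h] stand under the existential so that [choice] applies; for large [h] the
   value 0 is a placeholder. *)
have H h : exists c, h != 0 -> `|h| < e ->
    `|c - t| <= `|h| /\ f (h + t) - f t = df c * h.
  have [he|] := ltP `|h| e; last by move=> eh; exists 0.
  have [x xh xt|//|c cth E] := @MVT_signed f df t h; last by exists c.
  by apply: fdf => //; rewrite /= distrC (le_lt_trans xh).
have [c Hc] := choice H.
have cct : c h @[h --> 0^'] --> t.
  apply/cvgrPdist_lt => d d0; near=> h.
  have [||+ _] := Hc h; [by near: h; exact: nbhs_dnbhs_neq| |].
    by near: h; exact: dnbhs0_lt.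
  by rewrite distrC => /le_lt_trans; apply; near: h; exact: dnbhs0_lt.
have cdfc : df (c h) @[h --> 0^'] --> df t.
  exact: cvg_comp _ _ cct cdf.
suff E : \forall h \near (0 : R)^', df (c h) = h^-1 * (f (h + t) - f t).
  exact: cvg_trans (near_eq_cvg E) cdfc.
near=> h; have h0 : h != 0 by near: h; exact: nbhs_dnbhs_neq.
have [||_ ->] := Hc h => //; first by near: h; exact: dnbhs0_lt.
by rewrite mulrC mulfK.
Unshelve. all: by end_near. Qed.

End RealDerivatives.

Section Flow.
Context {R : realType} {n m : nat} {G : lieGroupType R n}.
Variable Sigma : linear_control_system G m.
Implicit Types (s t : R) (x y g : G).
Local Notation phi := (flow Sigma).
Local Notation X := (drift Sigma).

Let automorphisms := flow_automorphisms Sigma.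

Lemma flowM t x y : phi t (x * y)%g = (phi t x * phi t y)%g.
Proof. by have [/(_ t)[]] := automorphisms. Qed.

Lemma flow0 x : phi 0 x = x.
Proof. by have [_ ->] := automorphisms. Qed.

Lemma flowD s t x : phi (s + t) x = phi s (phi t x).
Proof. by have [_ _ ->] := automorphisms. Qed.

Lemma flow_fix1 t : phi t 1%g = 1%g.
Proof.
have := flowM t 1%g 1%g; rewrite mulg1.
by move=> /(congr1 (fun z => z * (phi t 1)^-1)%g); rewrite mulgK mulgV.
Qed.

Lemma continuous_flow t : continuous (phi t).
Proof. by have [/(_ t)[_ []]] := automorphisms. Qed.

Lemma continuous_orbit x : continuous (phi ^~ x).
Proof. by have [] := drift_flow Sigma x. Qed.

Lemma drift_smooth (f : G -> R) : smooth_fun f -> smooth_fun (X f).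
Proof. by move=> sf; have [+ _ _ _] := drift_vector_field Sigma; apply. Qed.

Lemma is_derive_flow (f : G -> R) x t : smooth_fun f ->
  is_derive t 1 (fun s => f (phi s x)) (X f (phi t x)).
Proof. by move=> sf; have [_ _ /(_ t f sf)] := drift_flow Sigma x. Qed.

(* Each [phi s] and each orbit is continuous, but not a priori the action
   [(s, x) |-> phi s x]; by Baire, the sets
   [{y | phi s y * y^-1 \in closure W for |s| <= 1 / (j + 1)}] cannot all be
   nowhere dense. *)
Lemma flow_jointly_continuous1 :
  phi p.1 p.2 @[p --> (0 : R, 1%g : G)] --> (1 : G)%g.
Proof.
move=> V /= /nbhs1_invmul[V1 /nbhs1_mul[V2 nV2 V21] V1V].
have [W nW WV2] := nbhs1_closed nV2.
pose E j := \bigcap_(s in [set s : R | `|s| <= j.+1%:R^-1])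
  [set y | closure W (phi s y * y^-1)%g].
have [| |j|y V2y|j [y0 [V2y0 nEy0]]] := @manifold_Baire _ _ G E (V2^°).
- exact: open_interior.
- by exists 1%g; exact: nV2.
- apply: closed_bigI => s _; apply: preimage_closed; last exact: closed_closure.
  move=> y _; apply: cvg_mulg; first exact: continuous_flow.
  by apply: cvg_invg; exact: cvg_id.
- have : (phi s y * y^-1)%g @[s --> (0 : R)] --> (1 : G)%g.
    have <- : (phi 0 y * y^-1)%g = 1%g by rewrite flow0 mulgV.
    exact: cvg_mulg (@continuous_orbit y 0) (cvg_cst _).
  move=> /(_ W nW)[e /= e0 eW].
  have [j je] : exists j, j.+1%:R^-1 < e.
    exists (Num.truncn e^-1); rewrite invf_plt ?posrE//.
    by rewrite truncnS_gt.
  exists j => // s /= sj; apply: subset_closure.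
  by apply: eW; rewrite /= sub0r normrN (le_lt_trans sj).
have nO : nbhs y0 (E j `&` V2).
  by apply: filterI => //.
have ncy : \forall y \near (1 : G)%g, (E j `&` V2) (y0 * y)%g.
  have : (y0 * y)%g @[y --> (1 : G)%g] --> y0.
    by rewrite -[in X in _ --> X](mulg1 y0); exact: cvg_mulg (cvg_cst _) cvg_id.
  by apply.
have ns : \forall s \near (0 : R), `|s| <= j.+1%:R^-1.
  by apply: nbhs0_le; rewrite invr_gt0.
exists ([set s : R | `|s| <= j.+1%:R^-1],
        [set y | (E j `&` V2) (y0 * y)%g]) => //.
move=> [s y] /= [sj [Ey V2y]].
have inV1 z : E j z -> V2 z -> V1 (phi s z).
  move=> Ez V2z; rewrite -(mulgVK z (phi s z)).
  by apply: V21 => //; exact/WV2/Ez.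
(* Baire gives control near some [y0]; the morphism property moves it to the identity. *)
have -> : phi s y = ((phi s y0)^-1 * phi s (y0 * y))%g by rewrite flowM mulKg.
apply: V1V; apply: inV1 => //; last exact: interior_subset V2y0.
exact: nbhs_singleton nEy0.
Qed.

(** Writing [y = (y * y0^-1) * y0] reduces joint continuity at [(0, y0)] to that at [(0, 1)] and to
    continuity of the orbit of [y0]. *)
Lemma cvg_flow (T : Type) (F : set_system T) {FF : Filter F} (s : T -> R)
    (y : T -> G) y0 : s z @[z --> F] --> 0 -> y z @[z --> F] --> y0 ->
  phi (s z) (y z) @[z --> F] --> y0.
Proof.
move=> cs cy.
have E : (fun z => phi (s z) (y z)) =
    (fun z => phi (s z) (y z * y0^-1) * phi (s z) y0)%g.
  by apply/funext => z; rewrite -flowM mulgVK.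
rewrite E -[in X in _ --> X](mul1g y0); apply: cvg_mulg; last first.
  rewrite -[in X in _ --> X](flow0 y0).
  exact: cvg_comp _ _ cs (@continuous_orbit y0 0).
have cyy : (y z * y0^-1)%g @[z --> F] --> (1 : G)%g.
  by rewrite -(mulgV y0); exact: cvg_mulg cy (cvg_cst _).
have := cvg_comp _ _ (cvg_pair cs cyy) flow_jointly_continuous1.
exact.
Qed.

(** The base point moves with [h], so the derivative of a single orbit is not enough: the mean value
    theorem gives the quotient as [a * X f] at a point [phi c (y h)], which tends to [y0] by joint
    continuity. *)
Lemma cvg_transport (f : G -> R) (a : R) (y : R -> G) y0 : smooth_fun f ->
  y h @[h --> 0^'] --> y0 ->
  h^-1 * (f (phi (a * h) (y h)) - f (y h)) @[h --> 0^'] --> a * X f y0.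
Proof.
move=> sf cy.
have H h : exists c, `|c| <= `|a * h| /\
    f (phi (a * h) (y h)) - f (y h) = X f (phi c (y h)) * (a * h).
  have [x _ _||c] := @MVT_signed R (fun s => f (phi s (y h)))
    (fun s => X f (phi s (y h))) 0 (a * h).
  - exact: is_derive_flow.
  - move=> s; apply: (@continuous_comp _ _ _ (phi ^~ (y h)) f).
      exact: continuous_orbit.
    exact: smooth_fun_continuous.
  by rewrite subr0 addr0 flow0 => ? ?; exists c.
have [c Hc] := choice H.
have cc : c h @[h --> 0^'] --> 0.
  have cah : a * h @[h --> (0 : R)^'] --> 0.
    rewrite -[in X in _ --> X](mulr0 a); apply: cvgMl_tmp; apply: cvg_within.
  apply/cvgr0Pnorm_le => d d0.
  move/cvgr0Pnorm_le : cah => /(_ d d0); apply: filterS => h.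
  by apply: le_trans; have [] := Hc h.
have cX : a * X f (phi (c h) (y h)) @[h --> 0^'] --> a * X f y0.
  apply: cvgMl_tmp.
  have cXf := @smooth_fun_continuous _ _ _ _ (drift_smooth sf) y0.
  exact: cvg_comp _ _ (cvg_flow cc cy) cXf.
suff E : \forall h \near (0 : R)^', a * X f (phi (c h) (y h)) =
    h^-1 * (f (phi (a * h) (y h)) - f (y h)).
  exact: cvg_trans (near_eq_cvg E) cX.
near=> h; have h0 : h != 0 by near: h; exact: nbhs_dnbhs_neq.
have [_ ->] := Hc h.
by rewrite mulrCA [h^-1 * _]mulrC mulfK// mulrC.
Unshelve. all: by end_near. Qed.

End Flow.

(** * Positive orbits *)

Lemma closure_sub_preimage (T U : topologicalType) (f : T -> U) (A : set T)
    (B : set U) : continuous f -> closed B -> (forall x, A x -> B (f x)) ->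
  forall x, closure A x -> B (f x).
Proof.
move=> /continuous_closedP cf cB AB x Ax.
by apply: (cf B cB); apply: closure_subset Ax.
Qed.

Lemma piecewise_constant_concat (R : realType) (T : Type) (u1 u2 : R -> T) t1 :
  piecewise_constant u1 -> piecewise_constant u2 ->
  piecewise_constant (fun s => if s < t1 then u1 s else u2 (s - t1)).
Proof.
move=> pc1 pc2 a b.
have [s1 H1] := pc1 a b; have [s2 H2] := pc2 (a - t1) (b - t1).
exists (t1 :: s1 ++ map (fun z => z + t1) s2) => x y ax xy yb nz.
have [xt|tx] := ltP x t1.
  have yt : y < t1.
    rewrite ltNge; apply/negP => ty; have := nz t1 (mem_head _ _).
    by rewrite ty (ltW xt).
  rewrite yt; apply: H1 => // z zs; apply: nz.
  by rewrite inE mem_cat zs orbT.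
rewrite ltNge (le_trans tx xy) /=; apply: H2; rewrite ?lerD2r ?ltrD2r// => z zs.
have := nz (z + t1); rewrite lerBlDr lerBrDr; apply.
by rewrite inE mem_cat (map_f (fun z => z + t1) zs) !orbT.
Qed.

Section Orbits.
Context {R : realType} {n m : nat} {G : lieGroupType R n}.
Variable Sigma : linear_control_system G m.
Implicit Types (s t : R) (x y g h : G) (w : 'rV[R]_m) (u : R -> 'rV[R]_m)
  (k c : R -> G).
Local Notation phi := (flow Sigma).
Local Notation X := (drift Sigma).
Local Notation orbit := (positive_orbit Sigma).

Lemma system_fieldE w (f : G -> R) x : system_field Sigma w f x =
  X f x + \sum_(i < m) w 0 i * input Sigma i f x.
Proof.
rewrite /system_field !fctE; congr (_ + _).
by rewrite !fct_sumE.
Qed.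

Lemma continuous_system_field w (f : G -> R) :
  smooth_fun f -> continuous (system_field Sigma w f).
Proof.
move=> sf; have -> : system_field Sigma w f =
    (fun x => X f x + \sum_(i < m) w 0 i * input Sigma i f x).
  by apply/funext => x; exact: system_fieldE.
move=> x; apply: cvgD.
  exact: (@smooth_fun_continuous _ _ _ _ (drift_smooth Sigma sf)).
apply: cvg_big => [|i _]; first exact: add_continuous.
apply: cvgMl_tmp.
have [[sY _ _ _] _] := input_right_invariant Sigma i.
exact: (@smooth_fun_continuous _ _ _ _ (sY f sf)).
Qed.

Lemma system_field0 : system_field Sigma 0 = X.
Proof.
rewrite /system_field big1 ?addr0// => i _.
by rewrite mxE scale0r.
Qed.

(* The solution from [x] is the solution from [1] translated by the orbit of
   [x] under the drift.  With [z = phi t x], the increment of [f] along the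
   product is split along
   [k (h + t) * phi (h + t) x = phi h (phi (- h) (k (h + t)) * z)]; right
   invariance of the inputs disposes of the translation by [z]. *)
Lemma velocity_mul_flow k t w x : {for t, continuous k} ->
  velocity_at k t (system_field Sigma w) ->
  velocity_at (fun s => k s * phi s x)%g t (system_field Sigma w).
Proof.
move=> ck vk f sf; set z := phi t x.
pose fz y := f (y * z)%g; have sfz : smooth_fun fz by exact: smooth_fun_mulr.
have ckh : k (h + t) @[h --> (0 : R)^'] --> k t.
  have c0 : h + t @[h --> (0 : R)^'] --> t.
    rewrite -[in X in _ --> X](add0r t); apply: cvg_within_filter.
    by apply: cvgD; [exact: cvg_id|exact: cvg_cst].
  exact: cvg_comp _ _ c0 ck.
have cN : - h @[h --> (0 : R)^'] --> (0 : R).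
  rewrite -[in X in _ --> X]oppr0; apply: cvgN; apply: cvg_within.
pose y (h : R) := (phi (- h) (k (h + t)) * z)%g.
have cy : y h @[h --> (0 : R)^'] --> (k t * z)%g.
  by apply: cvg_mulg; [exact: cvg_flow|exact: cvg_cst].
(* The drift need not be right-invariant: its contribution [X fz (k t)] to [T3] is cancelled by [T2]
   and replaced by [X f (k t * z)] from [T1]. The three increments telescope. *)
have T1 := @cvg_transport _ _ _ _ Sigma _ 1 _ _ sf cy.
have T2 := @cvg_transport _ _ _ _ Sigma _ (- 1) _ _ sfz ckh.
have /is_derive1P T3 := vk fz sfz.
apply/is_derive1P.
have E : system_field Sigma w f (k t * phi t x)%g =
    1 * X f (k t * z)%g + -1 * X fz (k t) + system_field Sigma w fz (k t).
  rewrite !system_fieldE -/z !mul1r mulN1r addrA subrK; congr (_ + _).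
  apply: eq_bigr => i _; congr (_ * _).
  have [_ Yinv] := input_right_invariant Sigma i.
  by rewrite /fz Yinv.
rewrite E; apply: cvg_trans (cvgD (cvgD T1 T2) T3).
apply: near_eq_cvg; apply: nearW => h /=; rewrite !fctE /=.
rewrite mul1r mulN1r -!mulrDr; congr (_ * _).
have -> : phi h (y h) = (k (h + t) * phi (h + t) x)%g.
  by rewrite /y flowM -!flowD subrr flow0.
rewrite /fz /y; lra.
Qed.

Lemma admissible0 : admissible Sigma (fun=> 0).
Proof.
split=> [a b|_]; first by exists [::].
by apply: interior_subset; exact: range_interior.
Qed.

Lemma solution_flow x : solution Sigma x (fun=> 0) (phi ^~ x).
Proof.
split; [exact: continuous_orbit|exact: flow0|].
by move=> t _; rewrite system_field0; have [_ _] := drift_flow Sigma x; apply.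
Qed.

Lemma positive_orbit_flow x t : 0 < t -> orbit x (phi t x).
Proof.
move=> t0; exists (fun=> 0), (phi ^~ x), t.
by split=> //; [exact: admissible0|exact: solution_flow].
Qed.

Lemma solution_mul_flow u k x : solution Sigma 1%g u k ->
  solution Sigma x u (fun t => k t * phi t x)%g.
Proof.
move=> [ck k0 vk]; split.
- by move=> t; apply: cvg_mulg; [exact: ck|exact: continuous_orbit].
- by rewrite k0 flow0 mul1g.
- by move=> t ut; apply: velocity_mul_flow; [exact: ck|exact: vk].
Qed.

(** The delicate time is [t1]: if the joined control is constant near it, the equation is required
    there, though [c1] and [c2] need not satisfy it at that time. It follows from the equation at
    nearby times by [is_derive_removable]. *)
Lemma solution_concat x u1 u2 c1 c2 t1 :
  solution Sigma x u1 c1 -> solution Sigma (c1 t1) u2 c2 -> 0 < t1 ->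
  solution Sigma x (fun s => if s < t1 then u1 s else u2 (s - t1))
                   (fun s => if s < t1 then c1 s else c2 (s - t1)).
Proof.
move=> [cc1 c10 v1] [cc2 c20 v2] t10.
set u := fun s => _; set c := fun s => _.
have nearl t : t < t1 -> \forall s \near t, s < t1 by exact: lt_nbhsl.
have nearr t : t1 < t -> \forall s \near t, t1 < s by exact: lt_nbhsr.
have cshift t : s - t1 @[s --> t] --> t - t1.
  by apply: cvgB; [exact: cvg_id|exact: cvg_cst].
have cc2s t : c2 (s - t1) @[s --> t] --> c2 (t - t1).
  exact: cvg_comp _ _ (cshift t) (cc2 (t - t1)).
have cl t : t < t1 -> \forall s \near t, c1 s = c s.
  by move=> /nearl; apply: filterS => s st; rewrite /c st.
have cr t : t1 < t -> \forall s \near t, c2 (s - t1) = c s.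
  by move=> /nearr; apply: filterS => s ts; rewrite /c ltNge ltW.
have cc : continuous c.
  move=> t; have [tt1|t1t|->] := ltgtP t t1.
  - have ct : c t = c1 t by rewrite /c tt1.
    rewrite /continuous_at ct.
    exact: cvg_trans (near_eq_cvg (cl t tt1)) (cc1 t).
  - have ct : c t = c2 (t - t1) by rewrite /c ltNge ltW.
    rewrite /continuous_at ct.
    exact: cvg_trans (near_eq_cvg (cr t t1t)) (cc2s t).
  - have ct : c t1 = c1 t1 by rewrite /c ltxx subrr c20.
    rewrite /continuous_at ct => V nV.
    have nV2 : nbhs (c2 (t1 - t1)) V by rewrite subrr c20.
    have n1 : \forall s \near t1, V (c1 s) := cc1 t1 V nV.
    have n2 : \forall s \near t1, V (c2 (s - t1)) := cc2s t1 V nV2.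
    suff : \forall s \near t1, V (c s) by [].
    by apply: filterS2 n1 n2 => s V1 V2; rewrite /c; case: ifP.
have off t : t != t1 -> (\forall s \near t, u s = u t) ->
    velocity_at c t (system_field Sigma (u t)).
  move=> tn ut f sf; have [tt1|t1t|tt1] := ltgtP t t1.
  - have Eu : u t = u1 t by rewrite /u tt1.
    have Ec : c t = c1 t by rewrite /c tt1.
    have ut1 : \forall s \near t, u1 s = u1 t.
      by apply: filterS2 ut (nearl t tt1) => s + st; rewrite Eu /u st.
    rewrite Eu Ec.
    refine (@near_eq_is_derive _ _ _ _ (f \o c) t 1 _ _ (v1 t ut1 f sf)).
    by apply: filterS (cl t tt1) => s /= ->.
  - have Eu : u t = u2 (t - t1) by rewrite /u ltNge ltW.
    have Ec : c t = c2 (t - t1) by rewrite /c ltNge ltW.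
    have ut2 : \forall s \near t - t1, u2 s = u2 (t - t1).
      have cadd : s + t1 @[s --> t - t1] --> t.
        rewrite -[in X in _ --> X](subrK t1 t).
        by apply: cvgD; [exact: cvg_id|exact: cvg_cst].
      have n1 : \forall s \near t - t1, u (s + t1) = u t := cadd _ ut.
      have n2 : \forall s \near t - t1, t1 < s + t1 := cadd _ (nearr t t1t).
      apply: filterS2 n1 n2 => s + ts.
      by rewrite Eu /u ltNge (ltW ts) /= addrK.
    have /is_derive1P D := v2 (t - t1) ut2 f sf.
    have D2 : is_derive t 1 (fun s => f (c2 (s - t1)))
        (system_field Sigma (u2 (t - t1)) f (c2 (t - t1))).
      by apply/is_derive1P; under eq_fun do rewrite -addrA; exact: D.
    rewrite Eu Ec; refine (@near_eq_is_derive _ _ _ _ (f \o c) t 1 _ _ D2).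
    by apply: filterS (cr t t1t) => s /= ->.
  - by rewrite tt1 eqxx in tn.
split=> //; first by rewrite /c t10.
move=> t ut; have [tt1|] := eqVneq t t1; last by move=> tn; exact: off.
move=> f sf; apply: (@is_derive_removable _ (f \o c)
    (fun s => system_field Sigma (u t) f (c s))).
- have := near_join ut; rewrite /dnbhs /within /=; apply: filter_app.
  move: ut; apply: filterS => s us uus st.
  rewrite -us; apply: off => //; first by rewrite -tt1.
  by apply: filterS uus => s' ->; rewrite us.
- move=> s; apply: continuous_comp; first exact: cc.
  exact: smooth_fun_continuous.
- apply: (@continuous_comp _ _ _ c); first exact: cc.
  exact: continuous_system_field.
Qed.

Lemma positive_orbit_trans x y z : orbit x y -> orbit y z -> orbit x z.
Proof.
move=> [u1 [c1 [t1 [[pc1 r1] sol1 t10 <-]]]].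
move=> [u2 [c2 [t2 [[pc2 r2] sol2 t20 <-]]]].
exists (fun s => if s < t1 then u1 s else u2 (s - t1)).
exists (fun s => if s < t1 then c1 s else c2 (s - t1)).
exists (t1 + t2); split.
- split; first exact: piecewise_constant_concat.
  by move=> t; case: ifP.
- exact: solution_concat.
- exact: addr_gt0.
- by rewrite ltNge lerDl ltW//= addrAC subrr add0r.
Qed.

(** With [tau] the time at which [h] is reached, follow the drift from [x] for time [t - tau], then
    the control leading to [h]. *)
Lemma positive_orbit_mul_flow h : orbit 1%g h ->
  exists2 tau, 0 < tau & forall t x, tau < t -> orbit x (h * phi t x)%g.
Proof.
move=> [u [k [tau [adm sol tau0 <-]]]]; exists tau => // t x taut.
apply: (@positive_orbit_trans _ (phi (t - tau) x)).
  by apply: positive_orbit_flow; rewrite subr_gt0.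
exists u, (fun s => k s * phi s (phi (t - tau) x))%g, tau; split=> //.
  exact: solution_mul_flow.
by rewrite -flowD subrKC.
Qed.

End Orbits.

(** * The closure of the positive orbit of the identity *)

Section CompactSemigroup.
Context {R : realType} {n : nat} {G : lieGroupType R n}.

(* The powers of [r] stay in [C] and accumulate, so some of them approach the
   identity: [r^-1] is a limit of powers of [r]. *)
Lemma compact_stable_invr (C : set G) (r : G) : compact C -> C r ->
  (forall x, C x -> C (x * r)%g) -> forall x, C x -> C (x * r^-1)%g.
Proof.
move=> cC Cr Cmul x Cx.
have Cpow y i : C y -> C (y * r ^+ i)%g.
  move=> Cy; elim: i => [|i IH]; first by rewrite expg0 mulg1.
  by rewrite expgSr mulgA; exact: Cmul.
have [q [Cq clq]] : C `&` cluster ((fun i => r ^+ i.+1)%g @ \oo) !=set0.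
  apply: cC; suff : \forall i \near \oo, C (r ^+ i.+1)%g by [].
  by apply: nearW => i; rewrite expgS; exact: Cpow.
have cdiv : (x * p.1^-1 * p.2 * r^-1)%g @[p --> (q, q)] --> (x * r^-1)%g.
  rewrite -{2}(mulgVK q x).
  apply: cvg_mulg; last exact: cvg_cst.
  apply: cvg_mulg; last exact: cvg_snd.
  apply: cvg_mulg; first exact: cvg_cst.
  by apply: cvg_invg; exact: cvg_fst.
apply: (compact_closed manifold_hausdorff cC) => V /cdiv[[A B] [/= nA nB] AB].
have nAB : nbhs q (A `&` B) by exact: filterI.
have tail i : ((fun j => r ^+ j.+1)%g @ \oo)
    [set (r ^+ j.+1)%g | j in [set j | (i <= j)%N]].
  by exists i => // j /= ij; exists j.
(* Two powers close to [q] have a quotient close to the identity. Starting the second tail at [i.+1]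
   makes the point below equal to [x * r ^+ (j - i.+1)], which is in [C]. *)
have [_ [[i _ <-] [Ai _]]] := clq _ _ (tail 0%N) nAB.
have [_ [[j /= ij <-] [_ Bj]]] := clq _ _ (tail i.+1) nAB.
exists (x * (r ^+ i.+1)^-1 * r ^+ j.+1 * r^-1)%g.
split; last exact: (AB (_, _)).
have -> : j.+1 = (i.+1 + (j - i.+1).+1)%N by rewrite addnS subnKC.
rewrite expgnDr [(r ^+ (j - i.+1).+1)%g]expgSr !mulgA mulgVK mulgK.
exact: Cpow.
Qed.

End CompactSemigroup.

Section ControlSet.
Context {R : realType} {n m : nat} {G : lieGroupType R n}.
Variable Sigma : linear_control_system G m.
Local Notation phi := (flow Sigma).
Local Notation orbit := (positive_orbit Sigma).
Local Notation C := (closure (orbit 1%g)).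

Lemma positive_orbit1 : orbit 1%g 1%g.
Proof. by rewrite -{2}(flow_fix1 Sigma 1); exact: positive_orbit_flow. Qed.

Let continuous_mulr (r : G) : continuous (fun x : G => x * r)%g.
Proof. by move=> x; exact: cvg_mulg cvg_id (cvg_cst _). Qed.

Let continuous_mull (h : G) : continuous (fun x : G => h * x)%g.
Proof. by move=> x; exact: cvg_mulg (cvg_cst _) cvg_id. Qed.

Lemma closure_orbit_flow t x : 0 < t -> C x -> C (phi t x).
Proof.
move=> t0; apply: (closure_sub_preimage (@continuous_flow _ _ _ _ Sigma t)
  (@closed_closure _ _)) => y oy.
apply: subset_closure; apply: positive_orbit_trans oy _.
exact: positive_orbit_flow.
Qed.

Lemma controlled_invariant_closure_orbit : controlled_invariant Sigma C.
Proof.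
move=> x Cx; exists (fun=> 0), (phi ^~ x); split.
- exact: admissible0.
- exact: solution_flow.
- move=> t; rewrite le_eqVlt => /predU1P[<-|t0]; first by rewrite flow0.
  exact: closure_orbit_flow.
Qed.

(* If [phi t x] accumulates at [r] as [t] tends to infinity, then [h * r] is
   a limit of the points [h * phi t x] of the orbit of [x], for [h] in the
   orbit of the identity. *)
Lemma approximately_reachable_closure_orbit : compact C ->
  approximately_reachable Sigma C.
Proof.
move=> cC x Cx.
have [r [Cr clr]] : C `&` cluster (phi ^~ x @ +oo) !=set0.
  apply: cC; exists 0; split; first exact: num_real.
  by move=> t t0; exact: closure_orbit_flow.
(* Used twice: with [D] equal to [C], then to the closure of the orbit of [x]. *)
have limit (D : set G) : closed D ->
    (forall h, orbit 1%g h ->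
       exists tau, forall t, tau < t -> D (h * phi t x)%g) ->
    forall y, C y -> D (y * r)%g.
  move=> cD HD; apply: (closure_sub_preimage (@continuous_mulr r) cD).
  move=> h oh; have [tau Htau] := HD h oh; apply: cD => V nV.
  have late : (phi ^~ x @ +oo) [set phi t x | t in [set t | tau < t]].
    by exists tau; split=> [|t taut]; [exact: num_real|exists t].
  have [_ [[t /= taut <-] Vt]] := clr _ _ late (continuous_mull nV).
  by exists (h * phi t x)%g; split=> //; exact: Htau.
have Cmulr y : C y -> C (y * r)%g.
  apply: limit; first exact: closed_closure.
  move=> h /positive_orbit_mul_flow[tau tau0 orb]; exists tau => t taut.
  (* As [x] is only in the closure, [F] is first applied to points of the orbit of the identity,
     then extended by continuity. *)
  pose F y := (h * phi t y)%g; have cF : continuous F.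
    by move=> z; apply: cvg_mulg; [exact: cvg_cst|exact: continuous_flow].
  suff : forall y, C y -> C (F y) by apply.
  apply: (closure_sub_preimage cF (@closed_closure _ _)) => z oz.
  by apply: subset_closure; apply: positive_orbit_trans oz _; exact: orb.
move=> y Cy; rewrite -(mulgVK r y).
apply: (limit (closure (orbit x))); first exact: closed_closure.
  move=> h /positive_orbit_mul_flow[tau _ orb]; exists tau => t taut.
  by apply: subset_closure; exact: orb.
exact: (compact_stable_invr cC Cr Cmulr Cy).
Qed.

(** For maximality, a larger candidate contains the identity, hence is contained in what is
    approximately reachable from it, namely [C]. *)
Lemma control_set_closure_orbit : compact C -> control_set Sigma C.
Proof.
move=> cC; split.
- exact: controlled_invariant_closure_orbit.
- exact: approximately_reachable_closure_orbit.
move=> D' _ reach CD'; apply/seteqP; split=> // y D'y.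
apply: (reach 1%g _ y D'y); apply: CD'; apply: subset_closure.
exact: positive_orbit1.
Qed.

End ControlSet.

Theorem corollary4p6 (R : realType) (n m : nat) (G : lieGroupType R n)
    (Sigma : linear_control_system G m)
    (G_connected : connected [set: G])
    (Sigma_LARC : LARC Sigma) :
  (bounded_subset (positive_orbit Sigma 1%g) <->
     compact (closure (positive_orbit Sigma 1%g)) /\
     control_set Sigma (closure (positive_orbit Sigma 1%g))) /\
  (bounded_subset (positive_orbit Sigma 1%g) -> controllable Sigma ->
     compact [set: G]).
Proof.
split; first split=> [cC|[]//].
  by split=> //; exact: control_set_closure_orbit.
(* Controllability makes the positive orbit of the identity dense. *)
move=> cC [_ reach _]; have -> : [set: G] = closure (positive_orbit Sigma 1%g).
  by apply/seteqP; split=> // x _; exact: (reach 1%g I x I).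
exact: cC.
Qed.
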